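(* Let $A$ be a commutative Noetherian ring. Then the monoid $(ic(A),* )$ is atomic. That is, every integrally closed ideal of $A$ containing a nonzerodivisor can be written as a (finite) $*$-product of $*$-irreducible ideals in $ic(A)$.
   Context: For an ideal $I$ of a commutative Noetherian ring $A$, the integral closure is $\overline{I}=\{x\in A : x^n+a_1x^{n-1}+\dots+a_n=0 \text{ for some } n\ge 1,\ a_i\in I^i\}$; $I$ is integrally closed if $\overline{I}=I$. Define $ic(A)=\{I : I \text{ is an integrally closed ideal of } A \text{ containing a nonzerodivisor}\}$ (the unit ideal $(1)=A$ is included), with operation $I*J=\overline{IJ}$; this is a commutative monoid with identity $(1)$. In a commutative monoid $(M,+)$ with identity $0$, an element $a$ is an atom if $a=x+y$ implies $x=0$ or $y=0$; $M$ is atomic if it is generated by its atoms. The atoms of $ic(A)$ are called $*$-irreducible ideals: $I\in ic(A)$ such that $I=\overline{JK}$ with $J,K\in ic(A)$ implies $J=(1)$ or $K=(1)$. The identity $(1)$ is regarded as the empty product. *)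

(* Defs.v *)
From HB Require Import structures.
From mathcomp Require Import all_boot all_order all_algebra.
From mathcomp Require Import mathcomp_extra boolp classical_sets.

Set Implicit Arguments.
Unset Strict Implicit.
Unset Printing Implicit Defensive.

Import GRing.Theory.
Local Open Scope classical_set_scope.
Local Open Scope ring_scope.

(* [nmodType] is MathComp's structure of (additive) commutative monoids. *)
Section Atomic.
Variable M : nmodType.

Definition atom (a : M) : Prop :=
  forall x y : M, a = x + y -> x = 0 \/ y = 0.

Definition atomic : Prop :=
  forall a : M, exists s : seq M,
    (forall x, x \in s -> atom x) /\ a = \sum_(x <- s) x.

End Atomic.

Section Ideals.
Variable A : comPzRingType.
Implicit Types (I J K S : set A) (x y d : A).

(* The ideals of ring_quotient are boolean and proper; here the unit ideal
   is allowed. *)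
Definition is_ideal I : Prop :=
  [/\ I 0, forall x y, I x -> I y -> I (x + y)
    & forall a x, I x -> I (a * x)].

Definition ideal_gen S : set A := smallest is_ideal S.

Definition noetherian : Prop :=
  forall I, is_ideal I -> exists s : seq A, I = ideal_gen [set` s].

Definition ideal_mul I J : set A := ideal_gen [set x * y | x in I & y in J].

Definition ideal_exp I (n : nat) : set A := iter n (ideal_mul I) setT.

Definition integral_closure I : set A :=
  [set x | exists n (a : nat -> A),
    [/\ (0 < n)%N, forall i, (1 <= i <= n)%N -> ideal_exp I i (a i)
      & x ^+ n + \sum_(1 <= i < n.+1) a i * x ^+ (n - i) = 0]].

Definition nonzerodivisor d : Prop := forall y, d * y = 0 -> y = 0.

Definition in_ic I : Prop :=
  [/\ is_ideal I, integral_closure I = I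
    & exists d, I d /\ nonzerodivisor d].

Record ic : Type := Ic { ic_val :> set A; icP : in_ic ic_val }.

Definition star_val I J : set A := integral_closure (ideal_mul I J).

Lemma is_ideal_gen S : is_ideal (ideal_gen S).
Proof.
split.
- by move=> K [[]].
- by move=> x y Sx Sy K KS; have [[_ D _] _] := KS; apply: D; [apply: Sx|apply: Sy].
- by move=> a x Sx K KS; have [[_ _ M] _] := KS; apply: M; apply: Sx.
Qed.

Lemma is_idealT : is_ideal setT. Proof. by []. Qed.

Lemma is_ideal_mul I J : is_ideal (ideal_mul I J).
Proof. exact: is_ideal_gen. Qed.

Lemma mem_ideal_mul I J x y : I x -> J y -> ideal_mul I J (x * y).
Proof. by move=> Ix Jy; apply: sub_gen_smallest; exists x => //; exists y. Qed.

Lemma ideal_mul_sub I J K :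
  is_ideal K -> (forall x y, I x -> J y -> K (x * y)) ->
  ideal_mul I J `<=` K.
Proof.
by move=> idK KIJ; apply: smallest_sub => // _ [x Ix [y Jy <-]]; apply: KIJ.
Qed.

Lemma is_ideal_exp I n : is_ideal (ideal_exp I n).
Proof. by case: n => [|n]; [exact: is_idealT|exact: is_ideal_mul]. Qed.

Lemma ideal_sum I (T : Type) (r : seq T) (P : pred T) (F : T -> A) :
  is_ideal I -> (forall i, P i -> I (F i)) -> I (\sum_(i <- r | P i) F i).
Proof. by move=> [I0 ID _] IF; elim/big_ind: _. Qed.

Lemma is_ideal_colon J K :
  is_ideal K -> is_ideal [set x | forall y, J y -> K (x * y)].
Proof.
move=> [K0 KD KM]; split=> /=.
- by move=> y _; rewrite mul0r.
- by move=> x y Kx Ky z Jz; rewrite mulrDl; apply: KD; [apply: Kx|apply: Ky].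
- by move=> a x Kx z Jz; rewrite -mulrA; apply: KM; apply: Kx.
Qed.

Lemma ideal_exp_mul I m n x y :
  ideal_exp I m x -> ideal_exp I n y -> ideal_exp I (m + n) (x * y).
Proof.
elim: m x y => [|m IHm] x y.
  by move=> _ Iy; have [_ _] := is_ideal_exp I n; apply.
move=> Ix Iy; move: x Ix y Iy; apply: ideal_mul_sub.
  exact/is_ideal_colon/is_ideal_exp.
move=> a b Ia Ib y Iy; rewrite -mulrA addSn.
by apply: mem_ideal_mul => //; apply: IHm.
Qed.

Lemma ideal_mulC I J : ideal_mul I J = ideal_mul J I.
Proof.
by apply/seteqP; split; apply: ideal_mul_sub (is_ideal_mul _ _) _ => x y Ix Jy;
  rewrite mulrC; apply: mem_ideal_mul.
Qed.

Lemma ideal_mulS I I' J : I `<=` I' -> ideal_mul I J `<=` ideal_mul I' J.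
Proof.
move=> II'; apply: ideal_mul_sub (is_ideal_mul _ _) _ => x y Ix Jy.
by apply: mem_ideal_mul Jy; apply: II'.
Qed.

Lemma ideal_mulA_sub I J K :
  ideal_mul (ideal_mul I J) K `<=` ideal_mul I (ideal_mul J K).
Proof.
apply: ideal_mul_sub (is_ideal_mul _ _) _ => x z IJx Kz.
move: x IJx z Kz; apply: ideal_mul_sub.
  exact/is_ideal_colon/is_ideal_mul.
move=> x y Ix Jy z Kz; rewrite -mulrA.
by do 2![apply: mem_ideal_mul => //].
Qed.

Lemma ideal_mulA I J K :
  ideal_mul I (ideal_mul J K) = ideal_mul (ideal_mul I J) K.
Proof.
apply/seteqP; split; last exact: ideal_mulA_sub.
rewrite ideal_mulC (ideal_mulC J) (ideal_mulC _ K) (ideal_mulC I).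
exact: ideal_mulA_sub.
Qed.

Lemma ideal_mul1l I : is_ideal I -> ideal_mul setT I = I.
Proof.
move=> idI; apply/seteqP; split.
  by apply: ideal_mul_sub => // x y _ Iy; have [_ _] := idI; apply.
by move=> x Ix; rewrite -[x]mul1r; apply: mem_ideal_mul.
Qed.

Lemma ideal_expS I J n : I `<=` J -> ideal_exp I n `<=` ideal_exp J n.
Proof.
move=> IJ; elim: n => //= n IHn.
apply: ideal_mul_sub (is_ideal_mul _ _) _ => x y Ix Iy.
by apply: mem_ideal_mul; [apply: IJ|apply: IHn].
Qed.

Lemma ideal_exp_mulX I J n x y :
  ideal_exp I n x -> J y -> ideal_exp (ideal_mul I J) n (x * y ^+ n).
Proof.
elim: n x => [//|n IHn] x Ix Jy.
suff: ideal_exp I n.+1 `<=`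
    [set x | forall z, z = y -> ideal_exp (ideal_mul I J) n.+1 (x * z ^+ n.+1)].
  by apply.
apply: ideal_mul_sub.
  have [K0 KD KM] := is_ideal_exp (ideal_mul I J) n.+1; split=> /=.
  - by move=> z _; rewrite mul0r.
  - by move=> u v Ku Kv z zy; rewrite mulrDl; apply: KD; [apply: Ku|apply: Kv].
  - by move=> a u Ku z zy; rewrite -mulrA; apply: KM; apply: Ku.
move=> a b Ia Ib z ->; rewrite exprS mulrACA.
by apply: mem_ideal_mul; [apply: mem_ideal_mul|apply: IHn].
Qed.

Lemma integral_closureS I J :
  I `<=` J -> integral_closure I `<=` integral_closure J.
Proof.
move=> IJ x [n [a [n0 Ia eq0]]]; exists n, a; split=> // i /Ia.
exact: ideal_expS.
Qed.

Lemma sub_integral_closure I : is_ideal I -> I `<=` integral_closure I.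
Proof.
move=> [_ _ IM] x Ix; exists 1%N, (fun=> - x); split=> //; last first.
  by rewrite big_nat1 subnn expr0 mulr1 expr1 subrr.
case=> [|[|//]] // _; rewrite -[- x]mulr1; apply: mem_ideal_mul => //.
by rewrite -mulN1r; apply: IM.
Qed.

Lemma integral_closure_mul I J :
  ideal_mul (integral_closure I) J `<=`
    ideal_gen (integral_closure (ideal_mul I J)).
Proof.
apply: ideal_mul_sub (is_ideal_gen _) _ => x y [n [a [n0 Ia eq0]]] Jy.
apply: sub_gen_smallest; exists n, (fun i => a i * y ^+ i); split=> //.
  by move=> i /Ia Iai; apply: ideal_exp_mulX.
move/(congr1 ( *%R^~ (y ^+ n))): eq0; rewrite /= mul0r.
move=> eq0; apply: etrans eq0; rewrite mulrDl -exprMn; congr (_ + _).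
rewrite mulr_suml; apply: eq_big_nat => i /andP[_]; rewrite ltnS => le_in.
rewrite -{3}(subnKC le_in) exprD exprMn.
by rewrite -!mulrA; congr (_ * _); rewrite mulrCA.
Qed.

End Ideals.

(* The integral closure is an ideal and is idempotent: x is in the integral
   closure of I iff x * 'X is integral over the Rees algebra of I. *)
Section Rees.
Variables (A : comNzRingType) (I : set A).

Definition rees_pred : {pred {poly A}} :=
  fun p => `[< forall i, ideal_exp I i p`_i >].

Lemma rees_subring : subring_closed rees_pred.
Proof.
split.
- apply/asboolP => i; rewrite coef1; case: i => [//|i].
  by have [] := is_ideal_exp I i.+1.
- move=> p q /asboolP Ip /asboolP Iq; apply/asboolP => i.
  have [_ D M] := is_ideal_exp I i.
  by rewrite coefB -mulN1r; apply: D => //; apply: M.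
- move=> p q /asboolP Ip /asboolP Iq; apply/asboolP => i.
  rewrite coefM; apply: ideal_sum; first exact: is_ideal_exp.
  move=> j _; have le_ji : (j <= i)%N by rewrite -ltnS.
  by rewrite -{1}(subnKC le_ji); apply: ideal_exp_mul.
Qed.

HB.instance Definition _ :=
  GRing.isSubringClosed.Build {poly A} rees_pred rees_subring.

Definition rees := {p : {poly A} | p \in rees_pred}.
HB.instance Definition _ := [isSub of rees for @sval _ _].
HB.instance Definition _ := [Choice of rees by <:].
HB.instance Definition _ := [SubChoice_isSubComNzRing of rees by <:].

Notation rint := (integralOver (\val : rees -> {poly A})).

Lemma rint_rees p : p \in rees_pred -> rint p.
Proof. by move=> Ip; apply: (integral_id _ (Sub p Ip : rees)). Qed.

Lemma rint_monomial i x : ideal_exp I i x -> rint (x%:P * 'X^i).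
Proof.
move=> Ix; apply: rint_rees; apply/asboolP => j.
rewrite coefCM coefXn; case: eqP => [->|_]; first by rewrite mulr1.
by rewrite mulr0; have [] := is_ideal_exp I j.
Qed.

Lemma rint_eq x n (a : nat -> A) :
    (forall i, (1 <= i <= n)%N -> rint ((a i)%:P * 'X^i)) ->
    x ^+ n + \sum_(1 <= i < n.+1) a i * x ^+ (n - i) = 0 ->
  rint (x%:P * 'X).
Proof.
move=> inta eq0.
pose q : {poly {poly A}} := \poly_(i < n) ((a (n - i)%N)%:P * 'X^(n - i)).
have szq : (size q < size ('X^n : {poly {poly A}}))%N.
  by rewrite size_polyXn ltnS size_poly.
apply: (@integral_root_monic _ _ _ _ ('X^n + q)).
- by rewrite monicE lead_coefDl // lead_coefXn.
- rewrite /root hornerD hornerXn horner_poly; apply/eqP.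
  move/(congr1 (fun c => c%:P * 'X^n)): eq0; rewrite polyC0 mul0r.
  move=> eq0; apply: etrans eq0; rewrite polyCD mulrDl polyC_exp exprMn; congr (_ + _).
  rewrite rmorph_sum mulr_suml /= big_add1 /= big_mkord.
  rewrite (reindex_inj rev_ord_inj) /=; apply: eq_bigr => i _.
  have le_in : (i.+1 <= n)%N by [].
  rewrite subKn // polyCM polyC_exp exprMn -!mulrA; congr (_ * _).
  by rewrite mulrCA -exprD subnKC.
- apply/integral_poly => i; rewrite coefD coefXn coef_poly.
  apply: integral_add; first exact: integral_nat.
  case: ifP => lt_in; last exact: integral0.
  by apply: inta; rewrite subn_gt0 lt_in leq_subr.
Qed.

Lemma closure_rint x : integral_closure I x <-> rint (x%:P * 'X).
Proof.
split=> [[n [a [_ Ia eq0]]]|[p mon_p]].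
  by apply: rint_eq eq0 => i /Ia; apply: rint_monomial.
have monq : map_poly (\val : rees -> {poly A}) p \is monic by rewrite monic_map.
set q := map_poly _ p in monq *; move=> /eqP qx0.
have Iq i : q`_i \in rees_pred by rewrite coef_map /=; apply: valP.
pose n := (size q).-1.
have szq : size q = n.+1 by rewrite prednK // size_poly_gt0 monic_neq0.
have qn : q`_n = 1 by move/monicP: monq.
exists n, (fun i => (q`_(n - i))`_i); split.
- rewrite lt0n; apply/eqP => n0; move: qx0 qn; rewrite horner_coef szq n0.
  by rewrite big_ord1 mulr1 /= => -> /esym/eqP; rewrite oner_eq0.
- by move=> i _; have /asboolP := Iq (n - i)%N; apply.
- move/(congr1 (fun r : {poly A} => r`_n)): qx0; rewrite coef0.
  move=> qx0; apply: etrans qx0; rewrite horner_coef szq coef_sum.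
  rewrite big_ord_recr /= qn mul1r addrC; congr (_ + _);
    first by rewrite exprMn -polyC_exp coefCM coefXn eqxx mulr1.
  rewrite big_add1 /= big_mkord [RHS](reindex_inj rev_ord_inj) /=.
  apply: eq_bigr => i _; rewrite exprMn -polyC_exp mulrCA coefCM mulrC.
  have le_in : (i.+1 <= n)%N by [].
  by rewrite coefMXn ltnNge leq_subr /= subKn.
Qed.

Lemma rees_closure_ideal : is_ideal (integral_closure I).
Proof.
split.
- by apply/closure_rint; rewrite polyC0 mul0r; apply: integral0.
- move=> x y /closure_rint Ix /closure_rint Iy; apply/closure_rint.
  by rewrite polyCD mulrDl; apply: integral_add.
- move=> a x /closure_rint Ix; apply/closure_rint.
  rewrite polyCM -mulrA; apply: integral_mul => //.
  by rewrite -[a%:P]mulr1; apply: (@rint_monomial 0).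
Qed.

Lemma rint_exp_closure i x :
  ideal_exp (integral_closure I) i x -> rint (x%:P * 'X^i).
Proof.
elim: i x => [|i IHi]; first by move=> x _; apply: (@rint_monomial 0).
suff : ideal_exp (integral_closure I) i.+1 `<=`
    [set x : A | rint (x%:P * 'X^(i.+1))].
  by apply.
apply: ideal_mul_sub => [|x y Ix Iy]; rewrite /mkset.
  split; rewrite /mkset.
  - by rewrite polyC0 mul0r; apply: integral0.
  - by move=> x y Ix Iy; rewrite polyCD mulrDl; apply: integral_add.
  - move=> a x Ix; rewrite polyCM -mulrA; apply: integral_mul => //.
    by rewrite -[a%:P]mulr1; apply: (@rint_monomial 0).
rewrite polyCM exprS mulrACA; apply: integral_mul; last exact: IHi.
exact/closure_rint.
Qed.

Lemma rees_closure_idem :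
  integral_closure (integral_closure I) `<=` integral_closure I.
Proof.
move=> x [n [a [_ Ia eq0]]]; apply/closure_rint.
by apply: rint_eq eq0 => i /Ia; apply: rint_exp_closure.
Qed.

End Rees.

Section ClosureFacts.
Variable A : comPzRingType.
Implicit Types I J K : set A.

Lemma closure0 I : integral_closure I 0.
Proof.
exists 1%N, (fun=> 0); split=> //.
- by move=> i _; have [] := is_ideal_exp I i.
- by rewrite big_nat1 mul0r addr0 expr1.
Qed.

Lemma integral_closure_facts I :
  is_ideal (integral_closure I) /\
  integral_closure (integral_closure I) `<=` integral_closure I.
Proof.
have [z|nz] := eqVneq (1 : A) 0.
  have c x : integral_closure I x.
    by rewrite -[x]mul1r z mul0r; apply: closure0.
  by split.
pose B : comNzRingType :=
  HB.pack (GRing.ComPzRing.sort A)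
    (GRing.PzSemiRing_isNonZero.Build (GRing.ComPzRing.sort A) nz).
split; [exact: (@rees_closure_ideal B)|exact: (@rees_closure_idem B)].
Qed.

Lemma is_ideal_closure I : is_ideal (integral_closure I).
Proof. by have [] := integral_closure_facts I. Qed.

Lemma integral_closureK I :
  integral_closure (integral_closure I) = integral_closure I.
Proof.
apply/seteqP; split; first by have [] := integral_closure_facts I.
exact/sub_integral_closure/is_ideal_closure.
Qed.

Lemma integral_closure_starl I J :
  is_ideal I -> star_val (integral_closure I) J = star_val I J.
Proof.
move=> idI; apply/seteqP; split; last first.
  apply: integral_closureS; apply: ideal_mulS.
  exact: sub_integral_closure.
rewrite -[X in _ `<=` X]integral_closureK; apply: integral_closureS.
apply: subset_trans (@integral_closure_mul _ _ _) _.
by apply: smallest_sub (is_ideal_closure _) _.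
Qed.

Lemma star_valC I J : star_val I J = star_val J I.
Proof. by rewrite /star_val ideal_mulC. Qed.

Lemma star_valA I J K :
  star_val I (star_val J K) = star_val (star_val I J) K.
Proof.
rewrite star_valC !integral_closure_starl; try exact: is_ideal_mul.
by rewrite star_valC /star_val ideal_mulA.
Qed.

Lemma in_ic1 : @in_ic A setT.
Proof.
split; first exact: is_idealT.
  by apply/seteqP; split=> //; apply: sub_integral_closure (@is_idealT A).
by exists 1; split=> // y; rewrite mul1r.
Qed.

Lemma in_ic_star I J : in_ic I -> in_ic J -> in_ic (star_val I J).
Proof.
move=> [_ _ [d [Id dP]]] [_ _ [e [Je eP]]]; split.
- exact: is_ideal_closure.
- exact: integral_closureK.
- exists (d * e); split; last by move=> y; rewrite -mulrA => /dP/eP.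
  by apply: sub_integral_closure (is_ideal_mul _ _) _ _; apply: mem_ideal_mul.
Qed.

End ClosureFacts.

Section IcMonoid.
Variable A : comPzRingType.

Definition ic_one : ic A := Ic (in_ic1 A).
Definition ic_star (I J : ic A) : ic A := Ic (in_ic_star (icP I) (icP J)).

Lemma ic_val_inj : injective (@ic_val A).
Proof. by move=> [I hI] [J hJ] /= e; case: J / e hJ => hJ; congr Ic. Qed.

Lemma ic_starA : associative ic_star.
Proof. by move=> I J K; apply: ic_val_inj; apply: star_valA. Qed.

Lemma ic_starC : commutative ic_star.
Proof. by move=> I J; apply: ic_val_inj; apply: star_valC. Qed.

Lemma ic_star1l : left_id ic_one ic_star.
Proof.
move=> I; apply: ic_val_inj; have [idI cI _] := icP I.
by rewrite /= /star_val ideal_mul1l.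
Qed.

HB.instance Definition _ := gen_eqMixin (ic A).
HB.instance Definition _ := gen_choiceMixin (ic A).

(* Additive notation: I + J is the star product, i.e. the integral closure of
   the ideal product IJ, and 0 is the unit ideal (1). *)
HB.instance Definition _ :=
  GRing.isNmodule.Build (ic A) ic_starA ic_starC ic_star1l.

Lemma ic_addE (I J : ic A) :
  ic_val (I + J) = integral_closure (ideal_mul I J).
Proof. by []. Qed.

Lemma ic_zeroE : ic_val (0 : ic A) = setT.
Proof. by []. Qed.

End IcMonoid.

(* Main.v *)
(* The monoid ic(A) has no nontrivial absorption: if I = I * K, then every
   generator x of I is integral over IK, so x^n lies in K I^n for large n, and
   hence I^N is contained in K I^N for some N.  By Nakayama's lemma some
   1 - k with k in K annihilates I^N, which contains a nonzerodivisor; so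
   1 = k lies in K.  In a nontrivial factorization I = J * K both factors are
   therefore strictly larger than I, and Noetherian induction concludes. *)
Require Import Defs.
From mathcomp Require Import all_boot all_order all_algebra.
From mathcomp Require Import mathcomp_extra boolp classical_sets.
From mathcomp Require Import ring.

Set Implicit Arguments.
Unset Strict Implicit.
Unset Printing Implicit Defensive.

Import GRing.Theory.
Local Open Scope classical_set_scope.
Local Open Scope ring_scope.

Section IdealLemmas.
Variable A : comPzRingType.
Implicit Types (I J K L : set A) (s : seq A).

(** * Finitely generated ideals and Nakayama's lemma *)

Lemma is_ideal_scaler K u : is_ideal K -> is_ideal [set x | K (u * x)].
Proof.
move=> [K0 KD KM]; split=> /= [|x y|a x]; first by rewrite mulr0.
- by rewrite mulrDr; apply: KD.
- by rewrite mulrCA; apply: KM.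
Qed.

Lemma ideal_gen_nil (z : A) : ideal_gen [set` [::]] z -> z = 0.
Proof.
have idz : is_ideal [set 0 : A].
  by split=> [//|_ _ -> ->|a _ ->] /=; rewrite ?addr0 ?mulr0.
by move=> Gz; apply: (Gz [set 0]); split.
Qed.

Lemma ideal_gen_cons x s z : ideal_gen [set` x :: s] z ->
  exists c, ideal_gen [set` s] (z - c * x).
Proof.
have [G0 GD GM] := is_ideal_gen [set` s].
suff: ideal_gen [set` x :: s] `<=`
    [set z | exists c, ideal_gen [set` s] (z - c * x)] by apply.
apply: smallest_sub; first split.
- by exists 0; rewrite mul0r subr0.
- move=> a b [c Gc] [d Gd]; exists (c + d).
  by have := GD _ _ Gc Gd; rewrite mulrDl opprD addrACA.
- move=> a b [c Gc]; exists (a * c).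
  by have := GM a _ Gc; rewrite mulrBr mulrA.
- move=> y /=; rewrite inE => /orP[/eqP ->|ys].
    by exists 1; rewrite mul1r subrr.
  by exists 0; rewrite mul0r subr0; apply: sub_gen_smallest.
Qed.

(** Keeping the coefficient of [x] inside [K] is what lets the multipliers in Nakayama's elimination
    stay congruent to 1 modulo [K]. *)
Lemma ideal_mul_gen_cons K x s z : is_ideal K ->
  ideal_mul K (ideal_gen [set` x :: s]) z ->
  exists2 k, K k & ideal_gen [set` s] (z - k * x).
Proof.
move=> [K0 KD KM]; have [G0 GD GM] := is_ideal_gen [set` s].
suff: ideal_mul K (ideal_gen [set` x :: s]) `<=`
    [set z | exists2 k, K k & ideal_gen [set` s] (z - k * x)] by apply.
apply: ideal_mul_sub; first split.
- by exists 0 => //; rewrite mul0r subr0.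
- move=> a b [c Kc Gc] [d Kd Gd]; exists (c + d); first exact: KD.
  by have := GD _ _ Gc Gd; rewrite mulrDl opprD addrACA.
- move=> a b [c Kc Gc]; exists (a * c); first exact: KM.
  by have := GM a _ Gc; rewrite mulrBr mulrA.
- move=> k y Kk /ideal_gen_cons[c Gc]; exists (k * c).
    by rewrite mulrC; apply: KM.
  by have := GM k _ Gc; rewrite mulrBr mulrA.
Qed.

(* Eliminates the generators of the ideal containing [u M] one at a time. *)
Lemma nakayama_elim M K s u : is_ideal K ->
  M `<=` ideal_mul K M -> [set` s] `<=` M -> K (1 - u) ->
  (forall m, M m -> ideal_gen [set` s] (u * m)) ->
  exists2 v, K (1 - v) & forall m, M m -> v * m = 0.
Proof.
move=> idK MKM; have [K0 KD KM] := idK.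
elim: s u => [|x s IHs] u sM Ku uM.
  by exists u => // m /uM /ideal_gen_nil.
have [G0 GD GM] := is_ideal_gen [set` s].
have Mx : M x by apply: sM; rewrite /= mem_head.
have: ideal_mul K (ideal_gen [set` x :: s]) (u * x).
  suff: ideal_mul K M `<=`
      [set z | ideal_mul K (ideal_gen [set` x :: s]) (u * z)].
    by apply; apply: MKM.
  apply: ideal_mul_sub => [|k m Kk Mm /=].
    exact/is_ideal_scaler/is_ideal_mul.
  by rewrite mulrCA; apply: mem_ideal_mul Kk (uM _ Mm).
move=> /(ideal_mul_gen_cons idK)[k Kk Gk].
(* As [u - k] sends [x] into the span of [s], multiplying by it removes the [x]-term from every
   [u * m], and the new multiplier is still 1 modulo [K]. *)
apply: (IHs (u * (u - k))) => [y ys|| m /uM /ideal_gen_cons[c Gc]].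
- by apply: sM; rewrite /= inE [y \in s]ys orbT.
- have -> : 1 - u * (u - k) = (1 + u) * (1 - u) + u * k by ring.
  by apply: KD; apply: KM.
- have -> : u * (u - k) * m = (u - k) * (u * m - c * x) + c * (u * x - k * x).
    by ring.
  by apply: GD; apply: GM.
Qed.

Lemma nakayama M K : noetherian A -> is_ideal M -> is_ideal K ->
  M `<=` ideal_mul K M -> exists2 v, K (1 - v) & forall m, M m -> v * m = 0.
Proof.
move=> hA idM idK MKM; have [s Ms] := hA M idM.
apply: (@nakayama_elim M K s 1) => // [||m Mm].
- by rewrite Ms; apply: sub_gen_smallest.
- by rewrite subrr; case: idK.
- by rewrite mul1r -Ms.
Qed.

(** * Powers of a finitely generated ideal *)

(** With [L] the span of [s], this expands [(L + Ax)^N] one factor at a time: [u] and [x ^+ b]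
    collect the choices already made, and [n] factors remain. Each further factor splits into a part
    in [L], raising [a], and a multiple of [x], raising [b]. *)
Lemma ideal_exp_gen_cons_sub x s T N a b n u y : is_ideal T ->
  (forall i j v, (i + j)%N = N -> ideal_exp (ideal_gen [set` s]) i v ->
    T (v * x ^+ j)) ->
  (a + b + n)%N = N -> ideal_exp (ideal_gen [set` s]) a u ->
  ideal_exp (ideal_gen [set` x :: s]) n y -> T (y * (u * x ^+ b)).
Proof.
move=> idT Tij; have [T0 TD TM] := idT.
elim: n a b u y => [|n IHn] a b u y.
  by rewrite addn0 => abN Lu _; apply: TM; apply: Tij abN Lu.
move=> abN Lu; move: y.
suff: ideal_exp (ideal_gen [set` x :: s]) n.+1 `<=`
    [set y | T (y * (u * x ^+ b))] by apply.
apply: ideal_mul_sub.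
  by under eq_set do rewrite mulrC; apply: is_ideal_scaler.
move=> z y /ideal_gen_cons[c Gc] Iy /=.
have -> : z * y * (u * x ^+ b) = y * (((z - c * x) * u) * x ^+ b) +
    c * (y * (u * x ^+ b.+1)) by rewrite exprS; ring.
apply: TD; last apply: TM.
  by apply: (IHn a.+1) => //; [rewrite -abN; ring|apply: mem_ideal_mul].
by apply: (IHn a) => //; rewrite -abN; ring.
Qed.

Lemma ideal_mul_expD I K m n x y : ideal_mul K (ideal_exp I m) x ->
  ideal_exp I n y -> ideal_mul K (ideal_exp I (m + n)) (x * y).
Proof.
move=> KIx Iy; move: x KIx.
suff: ideal_mul K (ideal_exp I m) `<=`
    [set x | ideal_mul K (ideal_exp I (m + n)) (x * y)] by apply.
apply: ideal_mul_sub.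
  by under eq_set do rewrite mulrC; apply/is_ideal_scaler/is_ideal_mul.
by move=> k z Kk Iz /=; rewrite -mulrA; apply: mem_ideal_mul => //;
  apply: ideal_exp_mul.
Qed.

Lemma mem_ideal_exp I n x : I x -> ideal_exp I n (x ^+ n).
Proof. by move=> Ix; elim: n => //= n ?; rewrite exprS; apply: mem_ideal_mul. Qed.

(** The surplus factors from [L] lie in [I], so they only raise the power of [I]. *)
Lemma ideal_exp_sub_leq I K L m n : L `<=` I ->
  ideal_exp L m `<=` ideal_mul K (ideal_exp I m) -> (m <= n)%N ->
  ideal_exp L n `<=` ideal_mul K (ideal_exp I n).
Proof.
move=> LI LK /subnKC <-; elim: (n - m)%N => [|k IHk]; first by rewrite addn0.
rewrite addnS; apply: ideal_mul_sub => [|x y Lx /IHk Ky]; first exact: is_ideal_mul.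
rewrite mulrC -addn1; apply: ideal_mul_expD Ky _.
by rewrite -[x]expr1; apply: mem_ideal_exp; apply: LI.
Qed.

Lemma ideal_exp_gen_sub I K s : is_ideal I -> [set` s] `<=` I ->
  (forall x, x \in s -> exists n, ideal_mul K (ideal_exp I n) (x ^+ n)) ->
  exists n, ideal_exp (ideal_gen [set` s]) n `<=` ideal_mul K (ideal_exp I n).
Proof.
move=> idI; elim: s => [_ _|x s IHs sI xK].
  (* Exponent 0 would fail here: the zeroth power of the zero ideal is the whole ring. *)
  exists 1%N; have idKI := is_ideal_mul K (ideal_exp I 1).
  apply: ideal_mul_sub => // x y /ideal_gen_nil -> _.
  by rewrite mul0r; case: idKI.
have Ix : I x by apply: sI; rewrite /= mem_head.
have s'I : [set` s] `<=` I.
  by move=> y ys; apply: sI; rewrite /= inE [y \in s]ys orbT.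
have LI : ideal_gen [set` s] `<=` I by apply: smallest_sub.
have [|m mP] := IHs s'I; first by move=> y ys; apply: xK; rewrite inE ys orbT.
have [n nP] := xK x (mem_head _ _).
exists (m + n)%N => y Iy.
have := @ideal_exp_gen_cons_sub x s (ideal_mul K (ideal_exp I (m + n)))
  (m + n) 0 0 (m + n) 1 y.
rewrite !mulr1; apply=> // [|i j v ijN Lv]; first exact: is_ideal_mul.
(* Pigeonhole on [i + j = m + n]: either [v] or [x ^+ j] has a large enough exponent to supply the
   factor [K], and the other lies in a power of [I]. *)
have [le_mi|lt_im] := leqP m i.
  rewrite -ijN; apply: ideal_mul_expD; last exact: mem_ideal_exp.
  exact: ideal_exp_sub_leq LI mP le_mi _ Lv.
have le_nj : (n <= j)%N by rewrite -(leq_add2l i) ijN leq_add2r ltnW.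
rewrite mulrC -ijN addnC -(subnKC le_nj) exprD -mulrA -addnA.
apply: ideal_mul_expD => //; apply: ideal_exp_mul; first exact: mem_ideal_exp.
exact: ideal_expS Lv.
Qed.

(** * Integral dependence and absorption *)

(** Solve the integral equation for [x ^+ n]: each [a i * x ^+ (n - i)] lies in [(KI)^i I^(n-i)],
    hence in [K I^n]. *)
Lemma integral_exp_mem I K x : is_ideal I -> is_ideal K -> I x ->
  integral_closure (ideal_mul K I) x ->
  exists n, ideal_mul K (ideal_exp I n) (x ^+ n).
Proof.
move=> idI idK Ix [n [a [_ aI eq0]]]; exists n.
have idT := is_ideal_mul K (ideal_exp I n); have [_ _ TM] := idT.
have -> : x ^+ n = -1 * \sum_(1 <= i < n.+1) a i * x ^+ (n - i).
  by apply/eqP; rewrite mulN1r -addr_eq0 eq0.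
apply: TM; rewrite big_seq_cond; apply: ideal_sum => // i.
rewrite andbT mem_index_iota ltnS => /[dup] /aI KIi /andP[i_gt0 le_in].
rewrite -(subnKC le_in) addKn; apply: ideal_mul_expD; last exact: mem_ideal_exp.
(* Since [i] is positive, one factor [K I] can be split off to provide [K]; the remaining ones are
   enlarged to [I]. *)
case: i i_gt0 KIi {le_in} => // i _.
apply: ideal_mul_sub => [|y z]; first exact: is_ideal_mul.
move=> KIy Iz; rewrite -add1n; apply: ideal_mul_expD; last first.
  by apply: ideal_expS Iz; apply: ideal_mul_sub => // k w _; case: idI => _ _; apply.
by rewrite /ideal_exp /= ideal_mulC [ideal_mul I _]ideal_mulC ideal_mul1l // ideal_mulC.
Qed.

Lemma ideal_absorption I K d : noetherian A -> is_ideal I -> is_ideal K ->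
  I d -> nonzerodivisor d -> I `<=` integral_closure (ideal_mul K I) ->
  K = setT.
Proof.
move=> hA idI idK Id dP IKI; have [s Is] := hA I idI.
have sI : [set` s] `<=` I by rewrite Is; apply: sub_gen_smallest.
have [|n] := @ideal_exp_gen_sub I K s idI sI.
  by move=> x xs; apply: integral_exp_mem (IKI _ _); try apply: sI.
rewrite -Is => /(nakayama hA (is_ideal_exp I n) idK)[v Kv vI].
have v0 : v = 0.
  (* [v] kills [d ^+ n], an element of [I^n]; cancel [d] one factor at a time. *)
  have := vI _ (mem_ideal_exp n Id); elim: (n) => [|k IHk]; first by rewrite mulr1.
  by rewrite exprS mulrCA => /dP.
apply/seteqP; split=> // x _; have [_ _ KM] := idK.
by have := KM x _ Kv; rewrite v0 subr0 mulr1.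
Qed.

(** * Noetherian induction *)

(** By contradiction: choice yields a strictly increasing chain [c] of counterexamples, whose union
    [U] is a finitely generated ideal, so the chain must stop. *)
Lemma noetherian_ind (P : set A -> Prop) : noetherian A ->
  (forall I, is_ideal I ->
     (forall J, is_ideal J -> I `<=` J -> I <> J -> P J) -> P I) ->
  forall I, is_ideal I -> P I.
Proof.
move=> hA IH I0 idI0; apply: contrapT => nPI0.
pose T := {I : set A | is_ideal I /\ ~ P I}.
have step (I : T) : {J : T | sval I `<=` sval J /\ sval I <> sval J}.
  case: I => I [idI nPI]; apply: cid; apply: contrapT => nJ; apply: (nPI).
  apply: IH => // J idJ IJ neIJ; apply: contrapT => nPJ.
  by apply: nJ; exists (exist _ J (conj idJ nPJ)).
pose c n : T := iter n (fun I : T => sval (step I)) (exist _ I0 (conj idI0 nPI0)).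
have cS n : sval (c n) `<=` sval (c n.+1) by case: (svalP (step (c n))).
have cleq m n : (m <= n)%N -> sval (c m) `<=` sval (c n).
  move/subnKC <-; elim: (n - m)%N => [|k IHk]; first by rewrite addn0.
  by rewrite addnS; apply: subset_trans IHk (cS _).
have idc n : is_ideal (sval (c n)) by case: (svalP (c n)).
pose U : set A := [set x | exists n, sval (c n) x].
have [|s Us] := hA U.
  split; first by exists 0%N; case: (idc 0%N).
  - move=> x y [m cx] [n cy]; exists (maxn m n); have [_ + _] := idc (maxn m n).
    by apply; [apply: cleq cx; apply: leq_maxl|apply: cleq cy; apply: leq_maxr].
  - by move=> a x [n cx]; exists n; have [_ _] := idc n; apply.
(* Each of the finitely many generators of [U] appears at some stage; the maximum of these stages
   works for all. *)
have [n sn] : exists n, forall x, x \in s -> sval (c n) x.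
  have: [set` s] `<=` U by rewrite Us; apply: sub_gen_smallest.
  elim: (s) => [|x t IHt] tU; first by exists 0%N.
  have [|m mP] := IHt; first by move=> y yt; apply: tU; rewrite /= inE [y \in t]yt orbT.
  have [n cx] : U x by apply: tU; rewrite /= mem_head.
  exists (maxn m n) => y; rewrite inE => /orP[/eqP ->|/mP cy].
    by apply: cleq cx; apply: leq_maxr.
  by apply: cleq cy; apply: leq_maxl.
have [_ []] := svalP (step (c n)); apply/seteqP; split; first exact: cS.
apply: (@subset_trans _ U) => [x cx|]; first by exists n.+1.
by rewrite Us; apply: smallest_sub.
Qed.

End IdealLemmas.

(** * Divisibility in the monoid of integrally closed ideals *)

Section Ic.
Variable A : comPzRingType.
Implicit Types I J : ic A.

(** The ideal product lies in [J], and [J] is its own integral closure. *)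
Lemma ic_add_sub I J : ic_val (I + J) `<=` J.
Proof.
have [idJ cJ _] := icP J; rewrite ic_addE -[X in _ `<=` X]cJ.
apply: integral_closureS; apply: ideal_mul_sub => // x y _.
by case: idJ => _ _; apply.
Qed.

Lemma ic_add_absorb I J : noetherian A -> I + J = J -> I = 0.
Proof.
move=> hA IJ; apply: ic_val_inj; have [idI _ _] := icP I.
have [idJ _ [d [Jd dP]]] := icP J; rewrite ic_zeroE.
by apply: (ideal_absorption hA idJ idI Jd dP); rewrite -ic_addE IJ.
Qed.

End Ic.

Theorem theorem1p2 (A : comPzRingType) (hA : noetherian A) : atomic (ic A).
Proof.
(* The induction runs over plain ideals, so [a] is quantified after its underlying set. *)
suff main (I : set A) : is_ideal I -> forall a : ic A, ic_val a = I ->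
    exists s : seq (ic A), (forall x, x \in s -> atom x) /\ a = \sum_(x <- s) x.
  by move=> a; apply: (main a) => //; case: (icP a).
apply: (noetherian_ind (P := fun I => forall a : ic A, ic_val a = I -> _)) I => //.
move=> I _ IH a aI; have [atom_a|] := pselect (atom a).
  by exists [:: a]; rewrite big_seq1; split=> // x; rewrite inE => /eqP ->.
(* The induction hypothesis applies to [y] because [a] is strictly smaller: [a = y] would give
   [x + y = y], forcing [x = 0] by absorption. *)
have factor (x y : ic A) : a = x + y -> x <> 0 ->
    exists s : seq (ic A), (forall z, z \in s -> atom z) /\ y = \sum_(z <- s) z.
  move=> axy x0; apply: (IH (ic_val y)) => //; first by case: (icP y).
    by rewrite -aI axy; apply: ic_add_sub.
  rewrite -aI => /ic_val_inj ay; apply: x0.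
  by apply: (ic_add_absorb hA (J := y)); rewrite -axy.
(* Without a factorization [a] would be an atom: a splitting into two nonzero terms would give one
   by concatenating theirs. *)
move=> natom; apply: contrapT => nfactor; apply: natom => x y axy.
apply: contrapT => /not_orP[x0 y0].
have [sy [syP ysum]] := factor x y axy x0.
have [sx [sxP xsum]] := factor y x (etrans axy (addrC x y)) y0.
apply: nfactor; exists (sx ++ sy); rewrite big_cat -xsum -ysum; split=> // z.
by rewrite mem_cat => /orP[/sxP|/syP].
Qed.
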